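(* Let $\mathcal{R}$ be a commutative ring with identity and $\frac12\in\mathcal{R}$, let $\mathcal{G}=\mathcal{G}(A,M,N,B)$ and $\mathcal{G}'=\mathcal{G}'(A',M',N',B')$ be two generalized matrix algebras over $\mathcal{R}$, and let $\mathfrak{l}\colon\mathcal{G}\to\mathcal{G}'$ be a Lie triple isomorphism. Suppose that (1) each centralizing trace of an arbitrary bilinear mapping on $\mathcal{G}'$ is proper; (2) at least one of $A,B$ and at least one of $A',B'$ are noncommutative; (3) $M'$ is loyal. Then $\mathfrak{l}=\pm\mathfrak{m}+\mathfrak{n}$, where $\mathfrak{m}\colon\mathcal{G}\to\mathcal{G}'$ is a Jordan homomorphism, $\mathfrak{m}$ is one-to-one, and $\mathfrak{n}\colon\mathcal{G}\to\mathcal{Z}(\mathcal{G}')$ is a linear mapping vanishing on each second commutator (i.e. $\mathfrak{n}([[x,y],z])=0$ for all $x,y,z\in\mathcal{G}$). Moreover, if $\mathcal{G}'$ is central over $\mathcal{R}$, then $\mathfrak{m}$ is onto.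
   Context: $\mathcal{Z}(\cdot)$ denotes the center of an algebra and $[x,y]=xy-yx$. A generalized matrix algebra $\mathcal{G}(A,M,N,B)$ over $\mathcal{R}$ arises from a Morita context: unital $\mathcal{R}$-algebras $A,B$, an $(A,B)$-bimodule $M$, a $(B,A)$-bimodule $N$, and bimodule homomorphisms $\Phi_{MN}\colon M\otimes_B N\to A$, $\Psi_{NM}\colon N\otimes_A M\to B$ (written $mn$, $nm$) satisfying $(mn)m'=m(nm')$ and $(nm)n'=n(mn')$ for all $m,m'\in M$, $n,n'\in N$. Then $\mathcal{G}$ is the $\mathcal R$-algebra of all matrices $\begin{bmatrix}a&m\\ n&b\end{bmatrix}$ ($a\in A$, $m\in M$, $n\in N$, $b\in B$) with matrix-like addition and multiplication. At least one of $M,N$ is nonzero. Standing assumption for all generalized matrix algebras considered: the bimodule in the upper right corner ($M$, resp. $M'$) is faithful as a left $A$-module (resp. $A'$-module) and as a right $B$-module (resp. $B'$-module). $M'$ is loyal if $aM'b=0$ (with $a\in A',b\in B'$) implies $a=0$ or $b=0$. The trace of an $\mathcal R$-bilinear map $\mathfrak{q}\colon \mathcal A\times\mathcal A\to\mathcal A$ on a unital $\mathcal R$-algebra $\mathcal{A}$ is $\mathfrak{T}_{\mathfrak{q}}(a)=\mathfrak{q}(a,a)$; it is centralizing if $[\mathfrak{T}_{\mathfrak{q}}(a),a]\in\mathcal{Z}(\mathcal{A})$ for all $a$, and a centralizing trace is proper if $\mathfrak{T}_{\mathfrak{q}}(a)=za^2+\mu(a)a+\nu(a)$ for all $a$, where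 $z\in\mathcal{Z}(\mathcal{A})$, $\mu\colon\mathcal{A}\to\mathcal{Z}(\mathcal{A})$ is $\mathcal R$-linear, and $\nu\colon\mathcal{A}\to\mathcal{Z}(\mathcal{A})$ is the trace of an $\mathcal R$-bilinear map $\mathcal{A}\times\mathcal{A}\to\mathcal{Z}(\mathcal{A})$. A Lie triple isomorphism is an $\mathcal{R}$-linear bijection $\mathfrak l$ with $\mathfrak l([[x,y],z])=[[\mathfrak l(x),\mathfrak l(y)],\mathfrak l(z)]$ for all $x,y,z$. A Jordan homomorphism is an $\mathcal{R}$-linear map $\mathfrak m$ with $\mathfrak{m}(x\circ y)=\mathfrak{m}(x)\circ\mathfrak{m}(y)$ for all $x,y$, where $x\circ y=xy+yx$. $\mathcal{G}'$ is central over $\mathcal{R}$ if $\mathcal{Z}(\mathcal{G}')=\mathcal{R}\cdot 1$. *)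

(* Defs.v *)
From HB Require Import structures.
From mathcomp Require Import all_boot all_algebra.

Set Implicit Arguments.
Unset Strict Implicit.
Unset Printing Implicit Defensive.

Import GRing.Theory.
Local Open Scope ring_scope.

(* The base ring acts centrally (r m = m r): both algebra actions induce the
   given R-module structure on M, since (r *: 1) m = r *: m = m (r *: 1). *)
HB.mixin Record Lmodule_isBimodule (R : comNzRingType) (A B : algType R) M
    of GRing.Lmodule R M := {
  lact : A -> M -> M;
  ract : M -> B -> M;
  lact1 : forall m, lact 1 m = m;
  lactA : forall a a' m, lact a (lact a' m) = lact (a * a') m;
  lactDl : forall a a' m, lact (a + a') m = lact a m + lact a' m;
  lactDr : forall a m m', lact a (m + m') = lact a m + lact a m';
  lactZl : forall r a m, lact (r *: a) m = r *: lact a m;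
  ract1 : forall m, ract m 1 = m;
  ractA : forall m b b', ract (ract m b) b' = ract m (b * b');
  ractDl : forall m m' b, ract (m + m') b = ract m b + ract m' b;
  ractDr : forall m b b', ract m (b + b') = ract m b + ract m b';
  ractZr : forall r m b, ract m (r *: b) = r *: ract m b;
  lract : forall a m b, ract (lact a m) b = lact a (ract m b)
}.

#[short(type="bimodType")]
HB.structure Definition Bimodule (R : comNzRingType) (A B : algType R) :=
  {M of GRing.Lmodule R M & Lmodule_isBimodule R A B M}.

(* A bimodule homomorphism M (x)_B N -> A is given, through the universal
   property of the tensor product, by a B-balanced bilinear map M -> N -> A
   which is A-linear on both sides; likewise for N (x)_A M -> B. *)
Record moritaContext (R : comNzRingType) (A B : algType R)
    (M : bimodType A B) (N : bimodType B A) := MoritaContext {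
  mulMN : {bilinear M -> N -> A};
  mulNM : {bilinear N -> M -> B};
  mulMN_balanced : forall m b n, mulMN (ract m b) n = mulMN m (lact b n);
  mulMN_lact : forall a m n, mulMN (lact a m) n = a * mulMN m n;
  mulMN_ract : forall m n a, mulMN m (ract n a) = mulMN m n * a;
  mulNM_balanced : forall n a m, mulNM (ract n a) m = mulNM n (lact a m);
  mulNM_lact : forall b n m, mulNM (lact b n) m = b * mulNM n m;
  mulNM_ract : forall n m b, mulNM n (ract m b) = mulNM n m * b;
  mulMNM : forall m n m', lact (mulMN m n) m' = ract m (mulNM n m');
  mulNMN : forall n m n', lact (mulNM n m) n' = ract n (mulMN m n')
}.

Record gma (R : comNzRingType) (A B : algType R)
    (M : bimodType A B) (N : bimodType B A) (C : moritaContext M N) :=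
  GMatrix { gA : A; gM : M; gN : N; gB : B }.

Section GMA.
Variables (R : comNzRingType) (A B : algType R).
Variables (M : bimodType A B) (N : bimodType B A) (C : moritaContext M N).
Local Notation G := (gma C).
Local Notation mx a m n b := (@GMatrix R A B M N C a m n b).
Implicit Types x y z : G.

Definition gma_tuple x : A * M * N * B := (gA x, gM x, gN x, gB x).
Definition tuple_gma (t : A * M * N * B) : G :=
  let: (a, m, n, b) := t in mx a m n b.
Fact gma_tupleK : cancel gma_tuple tuple_gma. Proof. by case. Qed.

HB.instance Definition _ := Choice.copy G (can_type gma_tupleK).

Definition gma_zero : G := mx 0 0 0 0.
Definition gma_opp x : G := mx (- gA x) (- gM x) (- gN x) (- gB x).
Definition gma_add x y : G :=
  mx (gA x + gA y) (gM x + gM y) (gN x + gN y) (gB x + gB y).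

Fact gma_addA : associative gma_add.
Proof. by move=> x y z; rewrite /gma_add /= !addrA. Qed.
Fact gma_addC : commutative gma_add.
Proof.
by case=> a m n b [a' m' n' b']; congr GMatrix; rewrite /= addrC.
Qed.
Fact gma_add0 : left_id gma_zero gma_add.
Proof. by case=> a m n b; congr GMatrix; rewrite /= add0r. Qed.
Fact gma_addN : left_inverse gma_zero gma_opp gma_add.
Proof. by case=> a m n b; congr GMatrix; rewrite /= addNr. Qed.

HB.instance Definition _ :=
  GRing.isZmodule.Build G gma_addA gma_addC gma_add0 gma_addN.

Definition gma_scale (r : R) x : G :=
  mx (r *: gA x) (r *: gM x) (r *: gN x) (r *: gB x).

Fact gma_scaleA r s x : gma_scale r (gma_scale s x) = gma_scale (r * s) x.
Proof. by congr GMatrix; rewrite /= scalerA. Qed.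
Fact gma_scale1 : left_id 1 gma_scale.
Proof. by case=> a m n b; congr GMatrix; rewrite /= scale1r. Qed.
Fact gma_scaleDr : right_distributive gma_scale +%R.
Proof. by move=> r x y; congr GMatrix; rewrite /= scalerDr. Qed.
Fact gma_scaleDl x : {morph gma_scale^~ x : r s / r + s}.
Proof. by move=> r s; congr GMatrix; rewrite /= scalerDl. Qed.

HB.instance Definition _ := GRing.Zmodule_isLmodule.Build R G
  gma_scaleA gma_scale1 gma_scaleDr gma_scaleDl.

Definition gma_one : G := mx 1 0 0 1.
Definition gma_mul x y : G :=
  mx (gA x * gA y + mulMN C (gM x) (gN y))
     (lact (gA x) (gM y) + ract (gM x) (gB y))
     (ract (gN x) (gA y) + lact (gB x) (gN y))
     (mulNM C (gN x) (gM y) + gB x * gB y).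

Lemma lact0l (A' B' : algType R) (V : bimodType A' B') (v : V) :
  lact (0 : A') v = 0.
Proof. by apply: (addrI (lact (0 : A') v)); rewrite -lactDl !addr0. Qed.
Lemma lact0r (A' B' : algType R) (V : bimodType A' B') (a : A') :
  lact a (0 : V) = 0.
Proof. by apply: (addrI (lact a (0 : V))); rewrite -lactDr !addr0. Qed.
Lemma ract0l (A' B' : algType R) (V : bimodType A' B') (b : B') :
  ract (0 : V) b = 0.
Proof. by apply: (addrI (ract (0 : V) b)); rewrite -ractDl !addr0. Qed.
Lemma ract0r (A' B' : algType R) (V : bimodType A' B') (v : V) :
  ract v (0 : B') = 0.
Proof. by apply: (addrI (ract v (0 : B'))); rewrite -ractDr !addr0. Qed.
Lemma lactZr (A' B' : algType R) (V : bimodType A' B') r (a : A') (v : V) :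
  lact a (r *: v) = r *: lact a v.
Proof. by rewrite -{1}[v]lact1 -lactZl lactA -scalerAr mulr1 lactZl. Qed.
Lemma ractZl (A' B' : algType R) (V : bimodType A' B') r (v : V) (b : B') :
  ract (r *: v) b = r *: ract v b.
Proof. by rewrite -{1}[v]ract1 -ractZr ractA -scalerAl mul1r ractZr. Qed.

Fact gma_mulA : associative gma_mul.
Proof.
move=> [a1 m1 n1 b1] [a2 m2 n2 b2] [a3 m3 n3 b3]; congr GMatrix => /=.
- rewrite !mulrDr !mulrDl !linearDl !linearDr /= mulMN_lact mulMN_ract.
  by rewrite mulMN_balanced !mulrA -!addrA; congr (_ + _); rewrite addrCA.
- rewrite !lactDr !lactDl !ractDr !ractDl !lactA !ractA mulMNM lract.
  by rewrite -!addrA; congr (_ + _); rewrite addrCA.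
- rewrite !lactDr !lactDl !ractDr !ractDl !lactA !ractA mulNMN lract.
  by rewrite -!addrA; congr (_ + _); rewrite addrCA.
rewrite !mulrDr !mulrDl !linearDl !linearDr /= mulNM_lact mulNM_ract.
by rewrite mulNM_balanced !mulrA -!addrA; congr (_ + _); rewrite addrCA.
Qed.
Fact gma_mul1l : left_id gma_one gma_mul.
Proof.
case=> a m n b; congr GMatrix => /=.
- by rewrite mul1r linear0l addr0.
- by rewrite lact1 ract0l addr0.
- by rewrite ract0l lact1 add0r.
by rewrite mul1r linear0l add0r.
Qed.
Fact gma_mul1r : right_id gma_one gma_mul.
Proof.
case=> a m n b; congr GMatrix => /=.
- by rewrite mulr1 linear0r addr0.
- by rewrite lact0r ract1 add0r.
- by rewrite ract1 lact0r addr0.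
by rewrite mulr1 linear0r add0r.
Qed.
Fact gma_mulDl : left_distributive gma_mul +%R.
Proof.
move=> x y z; congr GMatrix => /=;
  by rewrite ?mulrDl ?linearDl ?lactDl ?ractDl addrACA.
Qed.
Fact gma_mulDr : right_distributive gma_mul +%R.
Proof.
move=> x y z; congr GMatrix => /=;
  by rewrite ?mulrDr ?linearDr ?lactDr ?ractDr addrACA.
Qed.
Fact gma_1neq0 : gma_one != 0.
Proof. by apply/eqP => -[/eqP]; rewrite oner_eq0. Qed.

HB.instance Definition _ := GRing.Zmodule_isNzRing.Build G
  gma_mulA gma_mul1l gma_mul1r gma_mulDl gma_mulDr gma_1neq0.

Fact gma_scaleAl (r : R) x y : r *: (x * y) = (r *: x) * y.
Proof.
congr GMatrix => /=;
  by rewrite scalerDr ?scalerAl ?linearZl_LR ?lactZl ?ractZl.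
Qed.
HB.instance Definition _ := GRing.Lmodule_isLalgebra.Build R G gma_scaleAl.

Fact gma_scaleAr (r : R) x y : r *: (x * y) = x * (r *: y).
Proof.
congr GMatrix => /=;
  by rewrite scalerDr ?scalerAr ?linearZr_LR ?lactZr ?ractZr.
Qed.
HB.instance Definition _ := GRing.Lalgebra_isAlgebra.Build R G gma_scaleAr.

End GMA.

Section BimoduleProperties.
Variables (R : comNzRingType) (A B : algType R) (M : bimodType A B).

Definition left_faithful :=
  forall a : A, (forall m : M, lact a m = 0) -> a = 0.

Definition right_faithful :=
  forall b : B, (forall m : M, ract m b = 0) -> b = 0.

Definition loyal := forall (a : A) (b : B),
  (forall m : M, ract (lact a m) b = 0) -> a = 0 \/ b = 0.

Definition nonzero_bimod := exists m : M, m != 0.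

End BimoduleProperties.

Section RingNotions.
Variable S : nzRingType.

Definition noncommutative := ~ commutative (@GRing.mul S).

Definition central (x : S) := forall y, GRing.comm x y.

Definition lie_bracket (x y : S) := x * y - y * x.

Definition jordan_product (x y : S) := x * y + y * x.

End RingNotions.

Section AlgebraNotions.
Variables (R : comNzRingType) (S : algType R).

Definition bitrace (q : {bilinear S -> S -> S}) (x : S) := q x x.

Definition centralizing (f : S -> S) :=
  forall x, central (lie_bracket (f x) x).

Definition proper_trace (f : S -> S) :=
  exists (z : S) (mu : {linear S -> S}) (beta : {bilinear S -> S -> S}),
    [/\ central z,
        forall x, central (mu x),
        forall x y, central (beta x y) &
        forall x, f x = z * x ^+ 2 + mu x * x + bitrace beta x].

Definition central_over := forall x : S, central x <-> exists r : R, x = r%:A.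

End AlgebraNotions.

Section LinearMaps.
Variables (R : comNzRingType) (S S' : algType R).

Definition lie_triple_isomorphism (l : {linear S -> S'}) :=
  bijective l /\
  forall x y z, l (lie_bracket (lie_bracket x y) z)
                = lie_bracket (lie_bracket (l x) (l y)) (l z).

Definition jordan_homomorphism (m : {linear S -> S'}) :=
  forall x y, m (jordan_product x y) = jordan_product (m x) (m y).

End LinearMaps.

Arguments left_faithful {R A B} M.
Arguments right_faithful {R A B} M.
Arguments loyal {R A B} M.
Arguments nonzero_bimod {R A B} M.
Arguments central_over {R} S.

(* Main.v *)
Require Import Defs.
From HB Require Import structures.
From mathcomp Require Import all_boot all_algebra.

Set Implicit Arguments.
Unset Strict Implicit.
Unset Printing Implicit Defensive.

Import GRing.Theory.
Local Open Scope ring_scope.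

(** Write x o y for [jordan_product x y].  Since x commutes with its square, a
    Lie triple isomorphism l sends the pair x, x^2 to two elements whose
    commutator is central.  Hence (u, v) |-> l (l^-1 u * l^-1 v) is a bilinear
    map with a centralizing trace; properness of that trace, linearized, says
      l (x o y) = lam (l x o l y) + mu x * l y + mu y * l x + nu x y
    with lam, mu, nu central ([lie3_iso_jordan_relation]).

    Double commutators are Jordan expressions,
      [[x, y], z] = x o (y o z) - y o (x o z),
    so the image of [[x, y], z] under l can also be computed from the relation
    above.  Comparing it with [[l x, l y], l z] shows, modulo the centre,
      (lam^2 - 1) [[l x, l y], l z] + F(y, z) * l x - F(x, z) * l y = 0
    where F (y, z) = 2 lam nu(y, z) + mu (y o z) - mu y * mu z
    ([lie_bracket_defect_central]).  In a generalized matrix algebra with a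
    faithful loyal corner and a noncommutative diagonal block, such a functional
    identity has only the trivial solution ([lie_functional_identity]): testing
    it on the idempotent e = diag(1, 0) and on elements of the corner M makes
    the coefficient lam^2 - 1 annihilate all commutators of the diagonal blocks,
    and then F vanishes as well.

    Loyalty makes the centre a domain, so lam = s with s = 1 or s = -1.  Now
    F = 0 is exactly what is needed for m = s l + mu / 2, obtained from l by
    completing the square, to be a Jordan homomorphism
    ([half_shift_jordan]).  Then l = s m + n with n = - s mu / 2 central valued;
    both m and s l turn double commutators into double commutators, whence n
    kills them.  The kernel of m consists of central elements and is stable
    under multiplication by G, hence is zero.  Finally m 1 = 1, so if the centre
    of G' is R 1, then the values of n, hence those of l, lie in the image
    of m. *)

(** * Central elements, Jordan products and commutators *)

Section Centre.
Variable S : nzRingType.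
Implicit Types c d x y z : S.

Lemma centralD c d : central c -> central d -> central (c + d).
Proof.
by move=> cC dC x; apply: commr_sym; apply: commrD; apply: commr_sym.
Qed.

Lemma centralN c : central c -> central (- c).
Proof. by move=> cC x; apply: commr_sym; apply: commrN; apply: commr_sym. Qed.

Lemma centralB c d : central c -> central d -> central (c - d).
Proof. by move=> cC dC; apply: centralD => //; apply: centralN. Qed.

Lemma centralM c d : central c -> central d -> central (c * d).
Proof.
by move=> cC dC x; apply: commr_sym; apply: commrM; apply: commr_sym.
Qed.

Lemma central1 : central (1 : S).
Proof. by move=> x; apply: commr_sym; apply: commr1. Qed.

Lemma jordanC x y : jordan_product x y = jordan_product y x.
Proof. exact: addrC. Qed.

Lemma jordanDr x y z :
  jordan_product x (y + z) = jordan_product x y + jordan_product x z.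
Proof. by rewrite /jordan_product mulrDr mulrDl addrACA. Qed.

Lemma jordanDl x y z :
  jordan_product (x + y) z = jordan_product x z + jordan_product y z.
Proof. by rewrite jordanC jordanDr !(jordanC z). Qed.

Lemma jordan_centralMr c x y :
  central c -> jordan_product x (c * y) = c * jordan_product x y.
Proof. by move=> cC; rewrite /jordan_product mulrDr !mulrA (cC x). Qed.

Lemma jordan_centralr c x :
  central c -> jordan_product x c = (c * x) *+ 2.
Proof. by move=> cC; rewrite /jordan_product (cC x) mulr2n. Qed.

Lemma jordan_centrall c x :
  central c -> jordan_product c x = (c * x) *+ 2.
Proof. by rewrite jordanC; apply: jordan_centralr. Qed.

Lemma lie_bracket_jordan x y z :
  lie_bracket (lie_bracket x y) z =
  jordan_product x (jordan_product y z) - jordan_product y (jordan_product x z).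
Proof.
rewrite /lie_bracket /jordan_product !(mulrDr, mulrDl, mulrN, mulNr) !mulrA.
rewrite !opprD opprK !addrA.
rewrite [RHS](ACl (1 * 5 * 8 * 4 * (2 * 7) * (3 * 6))) /=.
by rewrite !subrr !addr0.
Qed.

Lemma lie_bracketC_eq0 x y : central x -> lie_bracket x y = 0.
Proof. by move=> xC; rewrite /lie_bracket (xC y) subrr. Qed.

End Centre.

Section ScaledCentre.
Variables (R : comNzRingType) (S : algType R).

Lemma centralZ r (c : S) : central c -> central (r *: c).
Proof. by move=> cC x; rewrite /GRing.comm -scalerAl cC scalerAr. Qed.

Lemma jordanZr r (x y : S) :
  jordan_product x (r *: y) = r *: jordan_product x y.
Proof. by rewrite /jordan_product scalerDr -scalerAr -scalerAl. Qed.

Lemma jordanZl r (x y : S) :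
  jordan_product (r *: x) y = r *: jordan_product x y.
Proof. by rewrite jordanC jordanZr jordanC. Qed.

Lemma lie_bracket_shiftl r (c x y : S) :
  central c -> lie_bracket (r *: x + c) y = r *: lie_bracket x y.
Proof.
move=> cC; rewrite /lie_bracket mulrDl mulrDr (cC y) opprD addrACA subrr addr0.
by rewrite -scalerAl -scalerAr scalerBr.
Qed.

Lemma lie_bracket_shiftr r (c x y : S) :
  central c -> lie_bracket x (r *: y + c) = r *: lie_bracket x y.
Proof.
move=> cC; rewrite /lie_bracket mulrDl mulrDr (cC x) opprD addrACA subrr addr0.
by rewrite -scalerAl -scalerAr scalerBr.
Qed.

End ScaledCentre.

(** * Linear maps that are quadratic on Jordan products *)

Section QuadraticRelation.
Variables (R : comNzRingType) (S S' : algType R) (l : {linear S -> S'}).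
Hypothesis l_lie3 : forall x y z,
  l (lie_bracket (lie_bracket x y) z)
  = lie_bracket (lie_bracket (l x) (l y)) (l z).
Variables (lam : S') (mu : {linear S -> S'}) (nu : S -> S -> S').
Hypotheses (lamC : central lam) (muC : forall x, central (mu x)).
Hypothesis nuC : forall x y, central (nu x y).
Hypothesis l_jordan : forall x y, l (jordan_product x y) =
  lam * jordan_product (l x) (l y) + mu x * l y + mu y * l x + nu x y.

(** When lam^2 = 1, half of this is the amount by which lam l + mu / 2 fails to
    be multiplicative for the Jordan product. *)
Definition jordan_defect y z :=
  (lam * nu y z) *+ 2 + mu (jordan_product y z) - mu y * mu z.

Lemma central_jordan_defect y z : central (jordan_defect y z).
Proof.
apply: centralB; last exact: centralM.
apply: centralD => //; rewrite mulr2n.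
by apply: centralD; apply: centralM.
Qed.

(** The image of [[x, y], z] is computed twice: by hypothesis on l, and through
    [lie_bracket_jordan] with the quadratic relation applied twice to each
    term.  The second way yields lam^2 [[l x, l y], l z], the two terms in the
    defect, a central error, and terms symmetric in x and y that cancel in the
    difference. *)
Lemma lie_bracket_defect_central x y z :
  central ((lam * lam - 1) * lie_bracket (lie_bracket (l x) (l y)) (l z)
           + jordan_defect y z * l x - jordan_defect x z * l y).
Proof.
(* The last summand of T makes it symmetric in x and y; it is compensated by
   the negative term of the defect. *)
pose T x y := lam * mu y * jordan_product (l x) (l z)
  + lam * mu x * jordan_product (l y) (l z)
  + lam * mu z * jordan_product (l x) (l y)
  + mu x * mu y * l z + mu x * mu z * l y + mu y * mu z * l x.
pose k a b := mu a * nu b z + nu a (jordan_product b z).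
have kC a b : central (k a b) by apply: centralD => //; apply: centralM.
have TC : T x y = T y x.
  rewrite /T (jordanC (l y) (l x)) (muC y (mu x)).
  by rewrite [RHS](ACl (2 * 1 * 3 * 4 * 6 * 5)).
have expand a b : l (jordan_product a (jordan_product b z)) =
   lam * lam * jordan_product (l a) (jordan_product (l b) (l z))
     + jordan_defect b z * l a + T a b + k a b.
  rewrite l_jordan (l_jordan b) 3!jordanDr !jordan_centralMr //.
  rewrite (jordan_centralr _ (nuC _ _)).
  rewrite /jordan_defect /k /T.
  (* A Jordan product is convertible to a sum, so distributivity would expand
     it; abstracting the four products prevents that. *)
  generalize (jordan_product (l a) (jordan_product (l b) (l z)))
    (jordan_product (l a) (l z)) (jordan_product (l a) (l b))
    (jordan_product (l b) (l z)) => J1 J2 J3 J4.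
  rewrite !mulr2n !(mulrDr, mulrDl) mulNr !mulrA -(lamC (mu a)) !addrA.
  rewrite [LHS](ACl (1*4*5*10*2*6*3*7*8*9*11)) /=.
  rewrite [RHS](ACl (1*2*3*4*6*7*8*9*10*12*13*(11*5))) /=.
  by rewrite subrr addr0.
have cancel (p q f g t a b : S') :
    p - q - (p + f + t + a - (q + g + t + b)) + f - g = b - a.
  rewrite opprB !opprD !addrA.
  rewrite (ACl (1*7*(3*2)*(4*12)*(5*9)*(11*8)*6*10)) /=.
  by rewrite !subrr !add0r.
rewrite mulrBl mul1r -{2}l_lie3 !lie_bracket_jordan [l (_ - _)]linearB /=.
by rewrite !expand TC mulrBr cancel; apply: centralB.
Qed.
End QuadraticRelation.

(** * Completing the square *)

Section HalfShift.
Variables (R : comNzRingType) (S S' : algType R).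
Variables (l mu m : {linear S -> S'}) (nu : S -> S -> S') (s h : R).
Hypotheses (h2 : h * 2%:R = 1) (s2 : s * s = 1).
Hypothesis muC : forall x, central (mu x).
Hypothesis l_jordan : forall x y, l (jordan_product x y) =
  s%:A * jordan_product (l x) (l y) + mu x * l y + mu y * l x + nu x y.
Hypothesis defect0 : forall x y, jordan_defect s%:A mu nu x y = 0.
Hypothesis mE : forall x, m x = s *: l x + h *: mu x.

(** Expanding both sides, the terms in l agree because s^2 = 1 and the doubled
    mixed terms are halved; what remains is h times the defect. *)
Lemma half_shift_jordan : jordan_homomorphism m.
Proof.
have h2K (v : S') : h *: (v *+ 2) = v.
  by rewrite -scaler_nat scalerA h2 scale1r.
move=> x y; rewrite !mE l_jordan mulr_algl.
rewrite jordanDl 2!jordanDr !jordanZl !jordanZr.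
rewrite (jordan_centralr _ (muC y)) 2!(jordan_centrall _ (muC x)) h2K.
rewrite (scalerA h s) (mulrC h) -(scalerA s h) !h2K.
rewrite [LHS]addrC 3!scalerDr !scalerA s2 !scale1r.
have := congr1 (fun v => h *: v) (defect0 x y).
rewrite /jordan_defect mulr_algl !scalerBr scalerDr h2K scaler0.
move=> /subr0_eq <-.
rewrite [LHS]addrC [LHS](ACl (1 * 3 * 2 * 4 * 5)) /=.
by rewrite 2!addrA.
Qed.

Hypothesis l_lie3 : forall x y z,
  l (lie_bracket (lie_bracket x y) z)
  = lie_bracket (lie_bracket (l x) (l y)) (l z).

(** By [lie_bracket_jordan], m preserves double commutators, and so does s l
    since s^3 = s.  The difference h mu is central valued and thus drops out of
    the commutators of values of m, so it must vanish on double commutators. *)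
Lemma mu_lie3_eq0 x y z : mu (lie_bracket (lie_bracket x y) z) = 0.
Proof.
have m_lie3 : m (lie_bracket (lie_bracket x y) z) =
    lie_bracket (lie_bracket (m x) (m y)) (m z).
  by rewrite !lie_bracket_jordan linearB /= !half_shift_jordan.
have hmuC w : central (h *: mu w) by apply: centralZ.
have lieZ r (u v : S') : lie_bracket (r *: u) v = r *: lie_bracket u v.
  rewrite -[r *: u]addr0 lie_bracket_shiftl // => w.
  by apply: commr_sym; apply: commr0.
move: m_lie3; rewrite !mE !(lie_bracket_shiftl, lie_bracket_shiftr) //.
rewrite !lieZ (scalerA s s) s2 scale1r -l_lie3 => /eqP.
rewrite -subr_eq0 addrC addKr => /eqP hmu0.
by rewrite -[LHS]scale1r -h2 mulrC -scalerA hmu0 scaler0.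
Qed.

End HalfShift.

(** * Central elements of a generalized matrix algebra *)

Section GMATheory.
Variables (R : comNzRingType) (A B : algType R).
Variables (M : bimodType A B) (N : bimodType B A) (C : moritaContext M N).
Hypotheses (lfM : left_faithful M) (rfM : right_faithful M).
Local Notation G := (gma C).
Implicit Types x y z c : G.

Lemma gA_mul x y : gA (x * y) = gA x * gA y + mulMN C (gM x) (gN y).
Proof. by []. Qed.
Lemma gM_mul x y : gM (x * y) = lact (gA x) (gM y) + ract (gM x) (gB y).
Proof. by []. Qed.
Lemma gN_mul x y : gN (x * y) = ract (gN x) (gA y) + lact (gB x) (gN y).
Proof. by []. Qed.
Lemma gB_mul x y : gB (x * y) = mulNM C (gN x) (gM y) + gB x * gB y.
Proof. by []. Qed.
Lemma gA_add x y : gA (x + y) = gA x + gA y. Proof. by []. Qed.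
Lemma gM_add x y : gM (x + y) = gM x + gM y. Proof. by []. Qed.
Lemma gN_add x y : gN (x + y) = gN x + gN y. Proof. by []. Qed.
Lemma gB_add x y : gB (x + y) = gB x + gB y. Proof. by []. Qed.
Lemma gA_opp x : gA (- x) = - gA x. Proof. by []. Qed.
Lemma gM_opp x : gM (- x) = - gM x. Proof. by []. Qed.
Lemma gN_opp x : gN (- x) = - gN x. Proof. by []. Qed.
Lemma gB_opp x : gB (- x) = - gB x. Proof. by []. Qed.

Definition gma_compE := (gA_mul, gM_mul, gN_mul, gB_mul, gA_add, gM_add,
  gN_add, gB_add, gA_opp, gM_opp, gN_opp, gB_opp).

(** Evaluates products in which some entries of the matrices are 0 or 1. *)
Definition gma_simp := (@lact0l R, @lact0r R, @ract0l R, @ract0r R, @lact1 R,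
  @ract1 R, @mulr0, @mul0r, @mulr1, @mul1r, @addr0, @add0r, @oppr0, @subr0,
  @sub0r, (linear0l (mulMN C)), (linear0r (mulMN C)), (linear0l (mulNM C)),
  (linear0r (mulNM C))).

Lemma lactNr a (m : M) : lact a (- m) = - lact a m.
Proof. by rewrite -scaleN1r lactZr scaleN1r. Qed.

Definition cornerA (a : A) : G := GMatrix C a 0 0 0.
Definition cornerM (m : M) : G := GMatrix C 0 m 0 0.
Definition cornerN (n : N) : G := GMatrix C 0 0 n 0.
Definition cornerB (b : B) : G := GMatrix C 0 0 0 b.

Lemma gmaP x y :
  gA x = gA y -> gM x = gM y -> gN x = gN y -> gB x = gB y -> x = y.
Proof. by case: x y => a m n b [a' m' n' b'] /= -> -> -> ->. Qed.

(** Commuting with the idempotent diag(1, 0) forces a central element to be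
    diagonal. *)
Lemma central_gM c : central c -> gM c = 0.
Proof.
move=> cC; have /(congr1 (@gM _ _ _ _ _ _)) := cC (cornerA 1).
by rewrite !gma_compE /= !gma_simp.
Qed.

Lemma central_gN c : central c -> gN c = 0.
Proof.
move=> cC; have /(congr1 (@gN _ _ _ _ _ _)) := cC (cornerA 1).
by rewrite !gma_compE /= !gma_simp.
Qed.

Lemma central_lract c (m : M) : central c -> lact (gA c) m = ract m (gB c).
Proof.
move=> cC; have /(congr1 (@gM _ _ _ _ _ _)) := cC (cornerM m).
by rewrite !gma_compE /= !gma_simp.
Qed.

Lemma central_gA c a : central c -> gA c * a = a * gA c.
Proof.
move=> cC; have /(congr1 (@gA _ _ _ _ _ _)) := cC (cornerA a).
by rewrite !gma_compE /= !gma_simp.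
Qed.

Lemma central_gB c b : central c -> gB c * b = b * gB c.
Proof.
move=> cC; have /(congr1 (@gB _ _ _ _ _ _)) := cC (cornerB b).
by rewrite !gma_compE /= !gma_simp.
Qed.

(** The two diagonal entries of a central element act on M in the same way, so
    by faithfulness each of them determines the other. *)
Lemma central_gA0 c : central c -> gA c = 0 -> c = 0.
Proof.
move=> cC cA0; apply: gmaP; rewrite ?(central_gM cC) ?(central_gN cC) //=.
by apply: rfM => m; rewrite -(central_lract m cC) cA0 lact0l.
Qed.

Lemma central_gB0 c : central c -> gB c = 0 -> c = 0.
Proof.
move=> cC cB0; apply: central_gA0 => //.
by apply: lfM => m; rewrite (central_lract m cC) cB0 ract0r.
Qed.

Lemma central_annul_upper c :
  central c -> (forall m : M, lact (gA c) m = 0) -> c = 0.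
Proof. by move=> cC /lfM; apply: central_gA0. Qed.

(** The centre contains no nonzero right ideal: x and x diag(1, 0) cannot
    both be central unless x = 0. *)
Lemma central_ideal_eq0 x : (forall y, central (x * y)) -> x = 0.
Proof.
move=> xC; have xC1 : central x by rewrite -[x]mulr1.
apply: central_gA0 => //; have /central_gB0 := xC (cornerA 1).
move/(_ _)/(congr1 (@gA _ _ _ _ _ _)).
by rewrite !gma_compE /= !gma_simp; apply.
Qed.

(** Commutators of x with elements of the four corners are concentrated in few
    entries; a central element that is off-diagonal, or has a zero diagonal
    entry, is zero. *)
Lemma central_of_lie_bracket x :
  (forall y, central (lie_bracket x y)) -> central x.
Proof.
rewrite /lie_bracket => xC.
(* Bracketing with diag(1, 0) isolates the off-diagonal entries. *)
have xM : gM x = 0.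
  have := central_gM (xC (cornerA 1)).
  by rewrite !gma_compE /= !gma_simp => /eqP; rewrite oppr_eq0 => /eqP.
have xN : gN x = 0.
  by have := central_gN (xC (cornerA 1)); rewrite !gma_compE /= !gma_simp.
have xMr (m : M) : lact (gA x) m = ract m (gB x).
  apply: subr0_eq; have := central_gM (xC (cornerM m)).
  by rewrite !gma_compE /= !gma_simp.
have xNr (n : N) : ract n (gA x) = lact (gB x) n.
  apply/esym; apply: subr0_eq; have := central_gN (xC (cornerN n)).
  by rewrite !gma_compE /= !gma_simp.
have xA a : gA x * a = a * gA x.
  apply: subr0_eq; have /central_gB0 := xC (cornerA a).
  rewrite !gma_compE /= ?xM ?xN !gma_simp.
  move=> /(_ erefl) /(congr1 (@gA _ _ _ _ _ _)).
  by rewrite !gma_compE /= !gma_simp.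
have xB b : gB x * b = b * gB x.
  apply: subr0_eq; have /central_gA0 := xC (cornerB b).
  rewrite !gma_compE /= ?xM ?xN !gma_simp.
  move=> /(_ erefl) /(congr1 (@gB _ _ _ _ _ _)).
  by rewrite !gma_compE /= !gma_simp.
by move=> y; apply: gmaP; rewrite !gma_compE ?xM ?xN !gma_simp.
Qed.

(** * A functional identity under loyalty *)

Section Loyal.
Hypothesis loyalM : loyal M.

(** If gA c * a = 0, then a M (gB c) = a (gA c) M = 0, and loyalty applies. *)
Lemma central_mulA0 c a : central c -> gA c * a = 0 -> c = 0 \/ a = 0.
Proof.
move=> cC ca0; have [m||] := loyalM (a := a) (b := gB c); last 2 first.
- by right.
- by left; apply: central_gB0.
by rewrite lract -central_lract // lactA -central_gA // ca0 lact0l.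
Qed.

Lemma central_mulB0 c b : central c -> gB c * b = 0 -> c = 0 \/ b = 0.
Proof.
move=> cC cb0; have [m||] := loyalM (a := gA c) (b := b); last 2 first.
- by left; apply: central_gA0.
- by right.
by rewrite central_lract // ractA cb0 ract0r.
Qed.

Lemma central_mul0 c x : central c -> c * x = 0 -> central x -> c = 0 \/ x = 0.
Proof.
move=> cC cx0 xC.
have := congr1 (@gA _ _ _ _ _ _) cx0; rewrite gA_mul (central_gM cC) !gma_simp.
by case/(central_mulA0 cC) => ?; [left | right; apply: central_gA0].
Qed.

(** Such a c annihilates every commutator of A and of B in the respective
    diagonal entry, and one of these commutators is nonzero. *)
Lemma central_comm_eq0 c : noncommutative A \/ noncommutative B -> central c ->
  (forall a a', GRing.comm (gA c * a) a') ->
  (forall b b', GRing.comm (gB c * b) b') -> c = 0.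
Proof.
move=> ncAB cC cA cB; case: (eqVneq c 0) => // /eqP c_neq0.
case: ncAB => [ncA | ncB].
- case: ncA => a a'; apply: subr0_eq.
  have [] // : c = 0 \/ a * a' - a' * a = 0.
  apply: central_mulA0 => //.
  by rewrite mulrBr !mulrA cA mulrA central_gA // subrr.
case: ncB => b b'; apply: subr0_eq.
have [] // : c = 0 \/ b * b' - b' * b = 0.
apply: central_mulB0 => //.
by rewrite mulrBr !mulrA cB mulrA central_gB // subrr.
Qed.

(** The substitutions all involve e = diag(1, 0), for which [[u, e], e] is the
    off-diagonal part of u.  The proof gets c = - f e e from the corner M, then
    c = 0 from the diagonal blocks, and the vanishing of f follows once the
    double commutator has disappeared. *)
Lemma lie_functional_identity c (f : G -> G -> G) :
  noncommutative A \/ noncommutative B -> central c ->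
  (forall v w, central (f v w)) ->
  (forall u v w,
     central (c * lie_bracket (lie_bracket u v) w + f v w * u - f u w * v)) ->
  c = 0 /\ forall v w, f v w = 0.
Proof.
move=> ncAB cC fC fid; set e := cornerA 1.
have fMN v w : (gM (f v w) = 0) * (gN (f v w) = 0).
  by rewrite central_gM ?central_gN.
have cMN : (gM c = 0) * (gN c = 0) by rewrite central_gM ?central_gN.
(* u = e, v in M, w = e; the M-entry must vanish. *)
have cfe : c + f e e = 0.
  apply: central_annul_upper => [|m]; first exact: centralD.
  have := central_gM (fid e (cornerM m) e).
  rewrite /lie_bracket !gma_compE /= !(fMN, cMN) !gma_simp.
  rewrite lactNr -opprD -lactDl => /eqP.
  by rewrite oppr_eq0 => /eqP.
have cu u : central (c * lie_bracket (lie_bracket u e) e - c * u - f u e * e).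
  by have := fid u e e; rewrite -(addr0_eq cfe) mulNr.
(* With v = w = e and u in A or in B, c u differs from a central element by a
   multiple of e. *)
have c0 : c = 0.
  apply: central_comm_eq0 => // [a a' | b b'].
  - have /central_gB0 := cu (cornerA a).
    rewrite /lie_bracket !gma_compE /= !(fMN, cMN) !gma_simp.
    move=> /(_ erefl) /(congr1 (@gA _ _ _ _ _ _)).
    rewrite !gma_compE /= !(fMN, cMN) !gma_simp subrr !gma_simp.
    move=> /eqP; rewrite subr_eq0 eqr_oppLR => /eqP ->.
    by rewrite -gA_opp; apply: central_gA; apply: centralN.
  have := central_gB b' (cu (cornerB b)).
  rewrite /lie_bracket !gma_compE /= !(fMN, cMN) !gma_simp.
  by rewrite mulNr mulrN => /oppr_inj.
have {}fid u v w : central (f v w * u - f u w * v).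
  by have := fid u v w; rewrite c0 mul0r add0r.
have fe w : f e w = 0.
  apply: central_annul_upper => // m; have := central_gM (fid (cornerM m) e w).
  by rewrite !gma_compE /= !fMN !gma_simp.
split=> // u w; apply: central_gA0 => //.
have /central_gB0 := fid u e w.
rewrite fe !gma_compE /= !fMN !gma_simp.
move=> /(_ erefl) /(congr1 (@gA _ _ _ _ _ _)).
rewrite !gma_compE /= !fMN !gma_simp.
by move=> /eqP; rewrite oppr_eq0 => /eqP.
Qed.
End Loyal.
End GMATheory.

(** * The quadratic relation of a Lie triple isomorphism *)

Section Linearization.
Variables (R : comNzRingType) (S S' : algType R) (l : {linear S -> S'}).
Hypothesis l_iso : lie_triple_isomorphism l.

(** The double commutators of l u, l v with any l w are images of
    [[u, v], w] = 0, and l is onto. *)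
Lemma lie3_iso_commuting_central u v :
  lie_bracket u v = 0 -> central (lie_bracket (l u) (l v)).
Proof.
case: l_iso => -[g lK gK] l3 uv0 w.
have := l3 u v (g w).
rewrite gK uv0 /lie_bracket mul0r mulr0 subrr linear0.
by move/esym; apply: subr0_eq.
Qed.

Hypothesis proper_traces : forall q : {bilinear S' -> S' -> S'},
  centralizing (bitrace q) -> proper_trace (bitrace q).

(** The trace of (u, v) |-> l (l^-1 u * l^-1 v) at l x is l (x^2); it is
    centralizing because x and x^2 commute.  The relation is the
    polarization of its proper form. *)
Lemma lie3_iso_jordan_relation :
  exists (lam : S') (mu : {linear S -> S'}) (nu : S -> S -> S'),
    [/\ central lam, forall x, central (mu x), forall x y, central (nu x y) &
    forall x y, l (jordan_product x y) =
      lam * jordan_product (l x) (l y) + mu x * l y + mu y * l x + nu x y].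
Proof.
have [[g lK gK] _] := l_iso.
pose gl : {linear S' -> S} :=
  HB.pack g (GRing.isLinear.Build R S' S *:%R g (can2_linear lK gK)).
pose q u v := l (gl u * gl v).
have q_bil : bilinear_for ( *:%R : R -> S' -> S') ( *:%R : R -> S' -> S') q.
  split=> w r u v; rewrite /q linearP ?mulrDl ?mulrDr linearD.
  - by rewrite -scalerAl linearZ.
  by rewrite -scalerAr linearZ.
pose qB : {bilinear S' -> S' -> S'} :=
  HB.pack q (bilinear_isBilinear.Build R S' S' S' *:%R *:%R q q_bil).
have [|lam [mu [beta [lamC muC betaC qE]]]] := proper_traces (q := qB).
  move=> u; rewrite /bitrace /= /q -{3}[u]gK; apply: lie3_iso_commuting_central.
  by rewrite /lie_bracket mulrA subrr.
exists lam, (mu \o l), (fun x y => beta (l x) (l y) + beta (l y) (l x)).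
split=> // [x|x y|x y]; [exact: muC | exact: centralD |].
have qlE x' : l (x' * x') =
    lam * (l x' * l x') + mu (l x') * l x' + beta (l x') (l x').
  by have := qE (l x'); rewrite /bitrace /= /q /= !lK expr2.
have polar (V : zmodType) (p a b r : V) : p + a + (b + r) - p - r = a + b.
  by rewrite addrA (ACl (2 * 3 * (1 * 5) * (4 * 6))) /= !subrr !addr0.
have jordan_polar (T : nzRingType) (u v : T) :
    jordan_product u v = (u + v) * (u + v) - u * u - v * v.
  by rewrite mulrDl !mulrDr polar.
have split3 (a1 a2 a3 b1 b2 b3 c1 c2 c3 : S') :
    a1 + a2 + a3 - (b1 + b2 + b3) - (c1 + c2 + c3) =
    (a1 - b1 - c1) + (a2 - b2 - c2) + (a3 - b3 - c3).
  by rewrite !opprD !addrA [LHS](ACl (1 * 4 * 7 * 2 * 5 * 8 * 3 * 6 * 9)).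
rewrite jordan_polar !linearB /= !qlE split3 -!mulrBr !linearD /= -jordan_polar.
rewrite mulrDl !mulrDr polar !linearDl /= polar.
by rewrite (addrC (beta (l y) _)) !addrA.
Qed.
End Linearization.

(** * Injectivity of the Jordan part *)

Section Kernel.
Variables (R : comNzRingType) (A B : algType R).
Variables (M : bimodType A B) (N : bimodType B A) (G : moritaContext M N).
Hypotheses (lfM : left_faithful M) (rfM : right_faithful M).
Variables (S' : algType R) (l m : {linear gma G -> S'}) (h : R).
Hypotheses (h2 : h * 2%:R = 1) (l_iso : lie_triple_isomorphism l).

(** If l x is central, then l kills every [[x, y], z], so all [x, y] are
    central. *)
Lemma lie3_iso_central_reflect x : central (l x) -> central x.
Proof.
have [l_bij l3] := l_iso; have l_inj := bij_inj l_bij; move=> lxC.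
apply: central_of_lie_bracket => // y z; apply: subr0_eq; apply: l_inj.
by rewrite l3 (lie_bracketC_eq0 _ lxC) /lie_bracket mul0r mulr0 subrr linear0.
Qed.

Hypothesis m_jordan : jordan_homomorphism m.
Hypothesis m_ker : forall x, m x = 0 -> central (l x).

(** If m x = 0, then x is central, so x o y = 2 x y and m (x y) = 0 for
    every y.  Hence x generates a central right ideal, which is zero. *)
Lemma jordan_injective_of_central_kernel : injective m.
Proof.
have ker x : m x = 0 -> x = 0.
  move=> mx0; have xC := lie3_iso_central_reflect (m_ker mx0).
  apply: central_ideal_eq0 => // y.
  apply: lie3_iso_central_reflect; apply: m_ker.
  have : m (jordan_product x y) = 0.
    by rewrite m_jordan mx0 /jordan_product mul0r mulr0 addr0.
  rewrite jordan_centrall // linearMn /= => /(congr1 (fun v => h *: v)).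
  by rewrite -scaler_nat scalerA h2 scale1r scaler0.
move=> x1 x2 m12; apply: subr0_eq; apply: ker.
by rewrite linearB /= m12 subrr.
Qed.
End Kernel.

Theorem proposition4p3 (R : comNzRingType)
  (half : exists h : R, h * 2%:R = 1)
  (A B : algType R) (M : bimodType A B) (N : bimodType B A)
  (G : moritaContext M N)
  (MN_neq0 : nonzero_bimod M \/ nonzero_bimod N)
  (M_lfaithful : left_faithful M) (M_rfaithful : right_faithful M)
  (A' B' : algType R) (M' : bimodType A' B') (N' : bimodType B' A')
  (G' : moritaContext M' N')
  (MN'_neq0 : nonzero_bimod M' \/ nonzero_bimod N')
  (M'_lfaithful : left_faithful M') (M'_rfaithful : right_faithful M')
  (l : {linear gma G -> gma G'})
  (l_iso : lie_triple_isomorphism l)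
  (proper_traces : forall q : {bilinear gma G' -> gma G' -> gma G'},
     centralizing (bitrace q) -> proper_trace (bitrace q))
  (AB_noncomm : noncommutative A \/ noncommutative B)
  (AB'_noncomm : noncommutative A' \/ noncommutative B')
  (M'_loyal : loyal M') :
  exists (m n : {linear gma G -> gma G'}),
    [/\ (forall x, l x = m x + n x) \/ (forall x, l x = - m x + n x),
        jordan_homomorphism m,
        injective m,
        (forall x, central (n x)) /\
        (forall x y z, n (lie_bracket (lie_bracket x y) z) = 0) &
        central_over (gma G') -> forall y, exists x, m x = y].
Proof.
have [h h2] := half.
have [[g lK gK] l3] := l_iso.
have [lam [mu [nu [lamC muC nuC l_jordan]]]] :=
  lie3_iso_jordan_relation l_iso proper_traces.
pose f v w := jordan_defect lam mu nu (g v) (g w).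
have [||u v w|lam2 defect0] := lie_functional_identity M'_lfaithful M'_rfaithful
  M'_loyal (c := lam * lam - 1) (f := f) AB'_noncomm.
- by apply: centralB; [apply: centralM | apply: central1].
- by move=> v w; apply: central_jordan_defect.
- have := lie_bracket_defect_central l3 lamC muC nuC l_jordan.
  by move/(_ (g u) (g v) (g w)); rewrite !gK.
have {f}defect0 x y : jordan_defect lam mu nu x y = 0.
  by have := defect0 (l x) (l y); rewrite /f !lK.
have [s [s1 s2 lamE]] :
    exists s : R, [/\ s = 1 \/ s = -1, s * s = 1 & lam = s%:A].
  have [] : lam - 1 = 0 \/ lam + 1 = 0.
  - apply: (central_mul0 M'_lfaithful M'_rfaithful M'_loyal).
    + by apply: centralB => //; apply: central1.
    + by rewrite mulrDr mulr1 mulrBl mul1r addrA subrK.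
    by apply: centralD => //; apply: central1.
  - move/subr0_eq => ->; exists 1; split; [by left | exact: mulr1 |].
    by rewrite scale1r.
  move/addr0_eq => lamE; exists (-1).
  split; [by right | by rewrite mulrNN mulr1 |].
  by rewrite scaleN1r -lamE opprK.
(* m and n are scaled so that l = s m + n, using s^2 = 1. *)
pose m : {linear gma G -> gma G'} := (s \*: l \+ h \*: mu)%R.
pose n : {linear gma G -> gma G'} := (- (s * h) \*: mu)%R.
have mE x : m x = s *: l x + h *: mu x by [].
have nC x : central (n x) by apply: centralZ.
have lE x : l x = s *: m x + n x.
  by rewrite mE scalerDr !scalerA s2 scale1r /n /= scaleNr addrK.
rewrite lamE in defect0 l_jordan.
have m_jordan := half_shift_jordan h2 s2 muC l_jordan defect0 mE.
have mu0 := mu_lie3_eq0 h2 s2 muC l_jordan defect0 mE l3.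
exists m, n; split=> //.
- case: s1 => s1; [left | right] => x; rewrite lE s1 ?scale1r //.
  by rewrite scaleN1r.
- apply: (jordan_injective_of_central_kernel _ _ h2 l_iso) => // x mx0.
  by rewrite lE mx0 scaler0 add0r.
- by split=> // x y z; rewrite /n /= mu0 scaler0.
have l1C : central (l 1).
  apply: (central_of_lie_bracket M'_lfaithful M'_rfaithful) => y.
  rewrite -[y]gK; apply: (lie3_iso_commuting_central l_iso).
  by rewrite /lie_bracket mul1r mulr1 subrr.
have m1C : central (m 1) by rewrite mE; apply: centralD; apply: centralZ.
have m1K x : m 1 * m x = m x.
  have := m_jordan 1 x; rewrite !jordan_centrall //; last exact: central1.
  rewrite mul1r linearMn /= => /(congr1 (fun v => h *: v)).
  by rewrite -!scaler_nat !scalerA h2 !scale1r.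
(* m 1 - 1 annihilates the image of m, and l agrees with s m modulo the centre;
   so m 1 - 1 generates a central right ideal. *)
have m1 : m 1 = 1.
  apply: subr0_eq; apply: (central_ideal_eq0 M'_lfaithful M'_rfaithful) => y.
  rewrite -[y]gK lE mulrDr -scalerAr mulrBl m1K mul1r subrr scaler0 add0r.
  by apply: centralM => //; apply: centralB => //; apply: central1.
move=> cen y; have [r nE] := (cen (n (g y))).1 (nC _).
exists (s *: g y + r *: 1).
by rewrite linearD !linearZ_LR m1 -nE -[RHS]gK lE.
Qed.
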